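(* Suppose the payoff kernels $(G_i)_{i\in[N]}$ satisfy the following separation structure: there exist a jointly measurable $\mathcal H:\Omega\times[0,\infty)^N\to\mathbb R$ and, for every $i\in[N]$, a jointly measurable $\mathcal U_i:\Omega\times[0,\infty)^{N-1}\to\mathbb R$ such that, for $\mathbb P$-a.e. $\omega$ and every $\mathbf t=(t_1,\dots,t_N)\in[0,\infty)^N$, $$G_i(\omega,\mathbf t)=\mathcal H(\omega,\mathbf t)+\mathcal U_i(\omega,\mathbf t^{-i}),$$ where $\mathbf t^{-i}=(t_j)_{j\ne i}$, and such that $\mathbb E\big[|\mathcal H(\omega,\tau)|+|\mathcal U_i(\omega,\tau^{-i})|\big]<\infty$ for every $\tau\in\mathcal T^N$ and $i\in[N]$. Define $$\Phi(\tau):=\mathbb E\big[\mathcal H(\omega,\tau^1,\dots,\tau^N)\big],\qquad\tau\in\mathcal T^N .$$ Then $\Phi$ is an exact potential function for the pure stopping game: for every $i\in[N]$, every $\tau\in\mathcal T^N$ and every $\widetilde\tau^i\in\mathcal T$, $$J_i(\widetilde\tau^i,\tau^{-i})-J_i(\tau^i,\tau^{-i})=\Phi(\widetilde\tau^i,\tau^{-i})-\Phi(\tau^i,\tau^{-i}).$$ Consequently the pure stopping game is an exact potential game (i.e. an $\alpha$-potential game with $\alpha=0$); in particular, every maximizer of $\Phi$ over $\mathcal T^N$ is a Nash equilibrium of the pure stopping game.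
   Context: Fix $N\ge 2$ and $[N]=\{1,\dots,N\}$. $(\Omega,\mathcal F,\mathbb F,\mathbb P)$ is a filtered probability space satisfying the usual conditions, where $\mathbb F=(\mathcal F_t)_{t\ge 0}$ is generated by a continuous exogenous state process. $\mathcal T$ is the set of $\mathbb F$-stopping times $\tau:\Omega\to[0,\infty)$. For each $i\in[N]$, $G_i:\Omega\times[0,\infty)^N\to\mathbb R$ is jointly measurable with $\sup_{\tau\in\mathcal T^N}\mathbb E[|G_i(\cdot,\tau)|]<\infty$, and the payoff of player $i$ is $J_i(\tau):=\mathbb E[G_i(\omega,\tau^1(\omega),\dots,\tau^N(\omega))]$. $(\sigma^i,\tau^{-i})$ denotes $\tau$ with $i$-th component replaced by $\sigma^i$. A profile $\tau\in\mathcal T^N$ is a Nash equilibrium if $J_i(\tau)\ge\sup_{\sigma^i\in\mathcal T}J_i(\sigma^i,\tau^{-i})$ for all $i$. A functional $\Phi:\mathcal T^N\to\mathbb R$ is an $\alpha$-potential function if $|[J_i(\widetilde\tau^i,\tau^{-i})-J_i(\tau)]-[\Phi(\widetilde\tau^i,\tau^{-i})-\Phi(\tau)]|\le\alpha$ for all $i$, $\tau\in\mathcal T^N$, $\widetilde\tau^i\in\mathcal T$; it is an exact potential function if $\alpha=0$. The game is called an $\alpha$-potential (exact potential) game if such a function exists. *)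

(* Defs.v *)
From HB Require Import structures.
From mathcomp Require Import all_boot all_order all_algebra.
From mathcomp Require Import all_classical all_reals all_analysis.

Set Implicit Arguments.
Unset Strict Implicit.
Unset Printing Implicit Defensive.

Import Order.TTheory GRing.Theory Num.Theory.
Import numFieldNormedType.Exports.

Local Open Scope classical_set_scope.
Local Open Scope ring_scope.

(* A family of sub-sigma-algebras of Omega is a function on R of which only
   the values at times t >= 0 are ever used; likewise for the state process. *)
Definition filtration (d : measure_display) (Omega : measurableType d)
    (R : realType) (F : R -> set (set Omega)) : Prop :=
  [/\ forall t, 0 <= t -> sigma_algebra [set: Omega] (F t),
      forall t, 0 <= t -> F t `<=` measurable &
      forall s t, 0 <= s -> s <= t -> F s `<=` F t].

Definition usual_conditions (d : measure_display) (Omega : measurableType d)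
    (R : realType) (P : probability Omega R) (F : R -> set (set Omega)) : Prop :=
  [/\ measure_is_complete P,
      P.-negligible `<=` F 0 &
      forall t, 0 <= t -> F t = \bigcap_(s in [set s | t < s]) F s].

Definition continuous_process (d : measure_display) (Omega : measurableType d)
    (R : realType) (P : probability Omega R) (E : topologicalType)
    (X : R -> Omega -> E) : Prop :=
  (forall t, 0 <= t ->
     preimage_set_system [set: Omega] (X t) <<s open >> `<=` measurable) /\
  {ae P, forall w, {within `[0, +oo[%classic, continuous (X ^~ w)}}.

Definition natural_filtration (Omega : Type) (R : realType)
    (E : topologicalType) (X : R -> Omega -> E) (t : R) : set (set Omega) :=
  <<s \bigcup_(u in `[0, t]%classic)
        preimage_set_system [set: Omega] (X u) <<s open >> >>.

(* F is the usual augmentation (null sets, then right limits) of the natural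
   filtration of X.  If the natural filtration itself, or its completion,
   already satisfies the usual conditions, it equals this augmentation. *)
Definition generated_by (d : measure_display) (Omega : measurableType d)
    (R : realType) (P : probability Omega R) (F : R -> set (set Omega))
    (E : topologicalType) (X : R -> Omega -> E) : Prop :=
  forall t, 0 <= t ->
    F t = \bigcap_(s in [set s | t < s])
            <<s natural_filtration X s `|` P.-negligible >>.

Record stopping_time (d : measure_display) (Omega : measurableType d)
    (R : realType) (F : R -> set (set Omega)) := StoppingTime {
  st_val :> Omega -> R ;
  st_ge0 : forall w, 0 <= st_val w ;
  st_adapted : forall t, 0 <= t -> F t [set w | st_val w <= t] }.

Definition profile (d : measure_display) (Omega : measurableType d)
    (R : realType) (F : R -> set (set Omega)) (N : nat) :=
  'I_N -> stopping_time F.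

Definition deviate (d : measure_display) (Omega : measurableType d)
    (R : realType) (F : R -> set (set Omega)) (N : nat)
    (tau : profile F N) (i : 'I_N) (s : stopping_time F) : profile F N :=
  fun j => if j == i then s else tau j.

Definition times (d : measure_display) (Omega : measurableType d)
    (R : realType) (F : R -> set (set Omega)) (N : nat)
    (tau : profile F N) (w : Omega) : N.-tuple R :=
  [tuple tau j w | j < N].

(* lift i enumerates the indices different from i in increasing order. *)
Definition remove_coord (R : Type) (N : nat) (i : 'I_N) (t : N.-tuple R) :
    N.-1.-tuple R :=
  [tuple tnth t (lift i j) | j < N.-1].

Definition orthant (R : realType) (n : nat) : set (n.-tuple R) :=
  [set t | forall j, 0 <= tnth t j].

(* A kernel Omega x [0, oo)^n -> R is represented by a function on
   Omega x R^n; its values outside the orthant are irrelevant. *)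
Definition jointly_measurable (d : measure_display) (Omega : measurableType d)
    (R : realType) (n : nat) (K : Omega -> n.-tuple R -> R) : Prop :=
  measurable_fun ([set: Omega] `*` @orthant R n)
    (fun x : Omega * n.-tuple R => K x.1 x.2).

Definition expected (d : measure_display) (Omega : measurableType d)
    (R : realType) (P : probability Omega R) (F : R -> set (set Omega))
    (N : nat) (K : Omega -> N.-tuple R -> R) (tau : profile F N) : R :=
  fine ('E_P[fun w => K w (times tau w)])%E.

Definition payoff (d : measure_display) (Omega : measurableType d)
    (R : realType) (P : probability Omega R) (F : R -> set (set Omega))
    (N : nat) (G : 'I_N -> Omega -> N.-tuple R -> R)
    (i : 'I_N) (tau : profile F N) : R :=
  expected P (G i) tau.

Definition L1_bounded_payoffs (d : measure_display)
    (Omega : measurableType d) (R : realType) (P : probability Omega R)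
    (F : R -> set (set Omega)) (N : nat)
    (G : 'I_N -> Omega -> N.-tuple R -> R) : Prop :=
  forall i, (ereal_sup [set 'E_P[fun w => `|G i w (times tau w)|%R] |
                         tau in [set: profile F N]] < +oo)%E.

Definition nash_equilibrium (d : measure_display) (Omega : measurableType d)
    (R : realType) (P : probability Omega R) (F : R -> set (set Omega))
    (N : nat) (G : 'I_N -> Omega -> N.-tuple R -> R)
    (tau : profile F N) : Prop :=
  forall i, (ereal_sup [set (payoff P G i (deviate tau i s))%:E |
                         s in [set: stopping_time F]]
             <= (payoff P G i tau)%:E)%E.

Definition alpha_potential_function (d : measure_display)
    (Omega : measurableType d) (R : realType) (P : probability Omega R)
    (F : R -> set (set Omega)) (N : nat)
    (G : 'I_N -> Omega -> N.-tuple R -> R)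
    (alpha : R) (Phi : profile F N -> R) : Prop :=
  forall (i : 'I_N) (tau : profile F N) (s : stopping_time F),
    `|(payoff P G i (deviate tau i s) - payoff P G i tau)
      - (Phi (deviate tau i s) - Phi tau)| <= alpha.

Definition exact_potential_function (d : measure_display)
    (Omega : measurableType d) (R : realType) (P : probability Omega R)
    (F : R -> set (set Omega)) (N : nat)
    (G : 'I_N -> Omega -> N.-tuple R -> R) (Phi : profile F N -> R) : Prop :=
  alpha_potential_function P G 0 Phi.

Definition alpha_potential_game (d : measure_display)
    (Omega : measurableType d) (R : realType) (P : probability Omega R)
    (F : R -> set (set Omega)) (N : nat)
    (G : 'I_N -> Omega -> N.-tuple R -> R) (alpha : R) : Prop :=
  exists Phi : profile F N -> R, alpha_potential_function P G alpha Phi.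

Definition exact_potential_game (d : measure_display)
    (Omega : measurableType d) (R : realType) (P : probability Omega R)
    (F : R -> set (set Omega)) (N : nat)
    (G : 'I_N -> Omega -> N.-tuple R -> R) : Prop :=
  alpha_potential_game P F G 0.

(* Main.v *)
Require Import Defs.
From HB Require Import structures.
From mathcomp Require Import all_boot all_order all_algebra.
From mathcomp Require Import all_classical all_reals all_analysis.
From mathcomp Require Import measurable_realfun.
Import Order.TTheory GRing.Theory Num.Theory.
Import numFieldNormedType.Exports.
Local Open Scope classical_set_scope.
Local Open Scope ring_scope.

(** Integrating the separation identity along a profile gives
    J_i(tau) = Phi(tau) + E[U_i(tau^{-i})], all three expectations being finite.
    The last term does not see the i-th component, so it cancels in the payoff
    difference of a unilateral deviation of player i. *)

(** Kernels are measurable relative to [[set: Omega]]*[orthant], so composing with them requires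
    this domain to be a measurable set; it is a finite intersection of half-spaces. *)
Lemma measurable_orthant (R : realType) (n : nat) :
  measurable (@orthant R n).
Proof.
have -> : @orthant R n =
    \bigcap_(j in [set: 'I_n]) ((@tnth n R ^~ j) @^-1` `[0, +oo[).
  apply/seteqP; split=> [t ht j _|t ht j] /=.
    by rewrite in_itv /= andbT; exact: ht.
  by have := ht j I; rewrite /= in_itv /= andbT.
apply: fin_bigcap_measurable => // j _.
by rewrite -[X in measurable X]setTI; exact: measurable_tnth.
Qed.

(** Open upper rays generate the Borel sets, and the preimage of such a ray is the complement of a
    set [tau <= t], which adaptedness places in [F t]. *)
Lemma measurable_stopping_time (d : measure_display) (Omega : measurableType d)
    (R : realType) (F : R -> set (set Omega)) (tau : stopping_time F) :
  filtration F -> measurable_fun [set: Omega] tau.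
Proof.
case=> _ Fmeas _.
apply: (measurability _ (RGenOInfty.measurableE R)) => _ [_ [t ->] <-].
rewrite setTI.
have -> : tau @^-1` `]t, +oo[ = ~` [set w | tau w <= t].
  apply/seteqP; split=> w /=; rewrite in_itv /= andbT ltNge.
    by move/negP.
  by move=> h; apply/negP.
apply: measurableC; have [t0|t0] := leP 0 t.
  by apply: (Fmeas t t0); exact: st_adapted.
(* For [t < 0] adaptedness says nothing, but [tau >= 0] makes the sublevel set empty. *)
rewrite [X in measurable X](_ : _ = set0)//.
apply/seteqP; split=> // w /= /le_lt_trans /(_ t0).
by rewrite ltNge st_ge0.
Qed.

Section measurability_along_profiles.
Context (d : measure_display) (Omega : measurableType d) (R : realType).
Implicit Types (F : R -> set (set Omega)).

(** The integrand is [K] after the graph map [w |-> (w, f w)]. This map has to stay inside the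
    domain on which [K] is measurable, hence the condition that [f] takes values in the orthant. *)
Lemma jointly_measurable_comp (n : nat) (K : Omega -> n.-tuple R -> R)
    (f : Omega -> n.-tuple R) :
  jointly_measurable K -> (forall w, orthant (f w)) ->
  (forall j, measurable_fun [set: Omega] (fun w => tnth (f w) j)) ->
  measurable_fun [set: Omega] (fun w => K w (f w)).
Proof.
move=> mK f0 mf.
apply: (@measurable_comp _ _ _ _ _ _ ([set: Omega] `*` @orthant R n)
  (fun x => K x.1 x.2) _ (fun w => (w, f w))) => //.
- by apply: measurableX => //; exact: measurable_orthant.
- by move=> _ [w _ <-] /=; exact: (conj I (f0 w)).
- by apply: measurable_fun_pair => //; exact/measurable_fun_tnthP.
Qed.

Lemma orthant_times F (N : nat) (tau : profile F N) (w : Omega) :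
  orthant (times tau w).
Proof. by move=> j; rewrite tnth_mktuple; exact: st_ge0. Qed.

Lemma measurable_kernel_times F (N : nat) (K : Omega -> N.-tuple R -> R)
    (tau : profile F N) :
  filtration F -> jointly_measurable K ->
  measurable_fun [set: Omega] (fun w => K w (times tau w)).
Proof.
move=> hF mK; apply: jointly_measurable_comp => // [w|j].
  exact: orthant_times.
under eq_fun do rewrite tnth_mktuple.
exact: measurable_stopping_time.
Qed.

Lemma measurable_kernel_remove_coord F (N : nat)
    (K : Omega -> N.-1.-tuple R -> R) (tau : profile F N) (i : 'I_N) :
  filtration F -> jointly_measurable K ->
  measurable_fun [set: Omega]
    (fun w => K w (remove_coord i (times tau w))).
Proof.
move=> hF mK; apply: jointly_measurable_comp => // [w j|j].
  by rewrite tnth_mktuple; exact: orthant_times.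
under eq_fun do rewrite !tnth_mktuple.
exact: measurable_stopping_time.
Qed.

(** [lift i] never takes the value [i], so the one component altered by the deviation is exactly the
    one dropped. *)
Lemma remove_coord_deviate F (N : nat) (tau : profile F N) (i : 'I_N)
    (s : stopping_time F) (w : Omega) :
  remove_coord i (times (deviate tau i s) w) = remove_coord i (times tau w).
Proof.
apply: eq_from_tnth => j; rewrite !tnth_mktuple /deviate.
by rewrite eq_sym (negbTE (neq_lift i j)).
Qed.

Lemma expected_separated (P : probability Omega R) F (N : nat)
    (Gi H : Omega -> N.-tuple R -> R) (i : 'I_N)
    (Ui : Omega -> N.-1.-tuple R -> R) (tau : profile F N) :
  filtration F -> jointly_measurable Gi -> jointly_measurable H ->
  jointly_measurable Ui ->
  {ae P, forall w, forall t : N.-tuple R,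
     orthant t -> Gi w t = H w t + Ui w (remove_coord i t)} ->
  ('E_P[fun w => (`|H w (times tau w)|
                  + `|Ui w (remove_coord i (times tau w))|)%R] < +oo)%E ->
  expected P Gi tau =
  expected P H tau + fine 'E_P[fun w => Ui w (remove_coord i (times tau w))].
Proof.
move=> hF mGi mH mUi sep; rewrite /expected unlock => intHU.
set h := fun w => H w (times tau w).
set u := fun w => Ui w (remove_coord i (times tau w)).
have mg : measurable_fun setT (fun w => Gi w (times tau w)).
  exact: measurable_kernel_times.
have mh : measurable_fun setT h by exact: measurable_kernel_times.
have mu : measurable_fun setT u by exact: measurable_kernel_remove_coord.
(* This nonnegative sum equals its own absolute value, so the bound [intHU] is its integrability; it
   then dominates [h] and [u] separately. *)
have inthu : P.-integrable setT (EFin \o (fun w => `|h w| + `|u w|)).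
  apply/integrableP; split.
    by apply/measurable_EFinP; apply: measurable_funD; exact: measurableT_comp.
  by under eq_integral do rewrite /= ger0_norm ?addr_ge0 //.
have inth : P.-integrable setT (EFin \o h).
  apply: le_integrable inthu => //; first exact/measurable_EFinP.
  by move=> w _ /=; rewrite lee_fin [leRHS]ger0_norm ?addr_ge0 // lerDl.
have intu : P.-integrable setT (EFin \o u).
  apply: le_integrable inthu => //; first exact/measurable_EFinP.
  by move=> w _ /=; rewrite lee_fin [leRHS]ger0_norm ?addr_ge0 // lerDr.
(* [fine] sends infinite values to 0 and is additive only on finite ones; integrability of [h] and
   [u] supplies the finiteness. *)
rewrite -fineD; [|exact: integrable_fin_num..].
rewrite -integralD_EFin //; congr fine.
apply: ae_eq_integral => //.
- exact/measurable_EFinP.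
- apply: (@eq_measurable_fun _ _ _ _ _ (EFin \o (h \+ u))) => //.
  by apply/measurable_EFinP; exact: measurable_funD.
(* The exceptional null set in [sep] is uniform in [t], so outside it the identity may be evaluated
   at the random vector [times tau w]. *)
- apply: filterS sep => w hw _ /=.
  by rewrite hw //; exact: orthant_times.
Qed.

End measurability_along_profiles.

Theorem proposition2p14 (d : measure_display) (Omega : measurableType d)
    (R : realType) (P : probability Omega R)
    (F : R -> set (set Omega))
    (hF : filtration F) (hFusual : usual_conditions P F)
    (E : topologicalType) (X : R -> Omega -> E)
    (hX : continuous_process P X) (hFX : generated_by P F X)
    (N : nat) (hN : (2 <= N)%N)
    (G : 'I_N -> Omega -> N.-tuple R -> R)
    (hGmeas : forall i, jointly_measurable (G i))
    (hGint : L1_bounded_payoffs P F G)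
    (H : Omega -> N.-tuple R -> R)
    (U : 'I_N -> Omega -> N.-1.-tuple R -> R)
    (hHmeas : jointly_measurable H)
    (hUmeas : forall i, jointly_measurable (U i))
    (hsep : forall i, {ae P, forall w, forall t : N.-tuple R,
        orthant t -> G i w t = H w t + U i w (remove_coord i t)})
    (hHUint : forall (tau : profile F N) (i : 'I_N),
        ('E_P[fun w => (`|H w (times tau w)|
                        + `|U i w (remove_coord i (times tau w))|)%R]
         < +oo)%E) :
  let Phi : profile F N -> R := expected P H in
  [/\ exact_potential_function P G Phi,
      forall (i : 'I_N) (tau : profile F N) (s : stopping_time F),
        payoff P G i (deviate tau i s) - payoff P G i tau
        = Phi (deviate tau i s) - Phi tau,
      exact_potential_game P F G &
      forall tau : profile F N,
        (forall sigma : profile F N, Phi sigma <= Phi tau) ->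
        nash_equilibrium P G tau].
Proof.
move=> Phi.
have exact i tau s : payoff P G i (deviate tau i s) - payoff P G i tau =
    Phi (deviate tau i s) - Phi tau.
  have payoffE sigma : payoff P G i sigma = Phi sigma +
      fine 'E_P[fun w => U i w (remove_coord i (times sigma w))].
    exact: expected_separated.
  rewrite !payoffE.
  under [in X in X - _]eq_fun do rewrite remove_coord_deviate.
  by rewrite opprD addrACA subrr addr0.
have potential : exact_potential_function P G Phi.
  by move=> i tau s; rewrite exact subrr normr0.
split=> //; first by exists Phi.
(* The supremum is bounded one deviation at a time: the payoff gain equals the gain in [Phi], which
   is nonpositive by maximality at [deviate tau i s]. *)
move=> tau Phi_max i; apply: ge_ereal_sup => _ [s _ <-].
by rewrite lee_fin -subr_le0 exact subr_le0.
Qed.
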